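(* Let $E=\{n_k\}_{k\ge1}\subseteq\mathbb{Z}$. (i) If $n_{k+1}/n_k\to\sigma$ where $\sigma>1$ is transcendental, then $\langle\zeta,E\rangle=\infty$ for any $m\ge1$ and any $\zeta_1,\dots,\zeta_m\in\mathbb{Z}\setminus\{0\}$. Thus $E$ enjoys $(\mathcal{I}_\infty)$. (ii) Let $n_k=[\sigma^k]$ with $\sigma>1$ algebraic, where $[x]$ denotes the integer part of $x$. Let $P(x)=\zeta_0+\zeta_1x+\dots+\zeta_dx^d$ be a nonzero polynomial with integer coefficients of minimal degree such that $P(\sigma)=0$. Then $\langle\zeta,E\rangle<\infty$, where $\zeta$ is the tuple of nonzero coefficients of $P$, and $E$ fails $(\mathcal{I}_{|\zeta_0|+\dots+|\zeta_d|})$.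
   Context: For $\zeta\in(\mathbb{Z}\setminus\{0\})^m$ and $E\subseteq\mathbb{Z}$, $$\langle\zeta,E\rangle=\sup_{G\subseteq E\text{ finite}}\inf\{|\zeta_1p_1+\dots+\zeta_mp_m|:p_1,\dots,p_m\in E\setminus G\text{ distinct}\}\in[0,\infty].$$ $E$ enjoys $(\mathcal{I}_n)$ if there is a finite $G\subseteq E$ such that $\zeta_1r_1+\dots+\zeta_mr_m\ne0$ for all $m\ge1$, all $\zeta\in(\mathbb{Z}\setminus\{0\})^m$ with $\sum\zeta_i=0$ and $\sum|\zeta_i|\le2n$, and all distinct $r_1,\dots,r_m\in E\setminus G$. $E$ enjoys $(\mathcal{I}_\infty)$ if it enjoys $(\mathcal{I}_n)$ for all $n\ge1$. ''Fails'' means does not enjoy. *)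

(* Defs.v *)
From HB Require Import structures.
From mathcomp Require Import all_boot all_order all_algebra.
From mathcomp Require Import all_classical all_reals all_analysis.
Set Implicit Arguments.
Unset Strict Implicit.
Unset Printing Implicit Defensive.
Import Order.TTheory GRing.Theory Num.Theory.
Import numFieldNormedType.Exports.
Local Open Scope classical_set_scope.
Local Open Scope ring_scope.

Definition lincomb (m : nat) (zeta p : m.-tuple int) : int :=
  \sum_(i < m) tnth zeta i * tnth p i.

Definition distinct_in (A : set int) (m : nat) (p : m.-tuple int) : Prop :=
  uniq p /\ forall x : int, x \in p -> A x.

(* The infimum is taken in \bar R, so it is +oo when A does not contain m
   distinct elements. *)
Definition inf_lincomb (R : realType) (m : nat) (zeta : m.-tuple int)
    (A : set int) : \bar R :=
  ereal_inf [set (`|lincomb zeta p|%:~R)%:E | p in distinct_in A (m := m)].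

Definition bracket (R : realType) (m : nat) (zeta : m.-tuple int)
    (E : set int) : \bar R :=
  ereal_sup [set inf_lincomb R zeta (E `\` G) |
    G in [set G : set int | finite_set G /\ G `<=` E]].

Definition enjoys_I (n : nat) (E : set int) : Prop :=
  exists G : set int, [/\ finite_set G, G `<=` E &
    forall (m : nat) (zeta : m.-tuple int),
      (1 <= m)%N -> 0 \notin (zeta : seq int) ->
      \sum_(i < m) tnth zeta i = 0 ->
      (\sum_(i < m) `|tnth zeta i|%N <= 2 * n)%N ->
      forall r : m.-tuple int, distinct_in (E `\` G) r ->
        lincomb zeta r != 0].

Definition enjoys_Ioo (E : set int) : Prop :=
  forall n : nat, (1 <= n)%N -> enjoys_I n E.

Definition terms (n_ : nat -> int) : set int :=
  [set n_ k | k in [set k : nat | (1 <= k)%N]].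

Definition minimal_degree_root (R : realType) (sigma : R) (P : {poly int}) :
    Prop :=
  [/\ P != 0, root (map_poly intr P) sigma &
    forall Q : {poly int}, Q != 0 -> root (map_poly intr Q) sigma ->
      (size P <= size Q)%N].

Definition nonzero_coefs (P : {poly int}) : seq int :=
  [seq c <- polyseq P | c != 0].

(* Main.v *)
(* (i) A combination of distinct terms with bounded coefficients, ordered by
   decreasing index, is at least a fixed fraction of its top term: terms at
   bounded distance from the top contribute about [Q(sigma)] times a term, for
   one of finitely many nonzero integer polynomials [Q], and all terms after a
   long enough gap are negligible.
   (ii) Since [P(sigma) = 0], the integers [\sum_i P`_i * n_ (k + i)] are bounded
   by [\sum_i |P`_i|] uniformly in [k], hence two of them, far apart, are equal. *)
Require Import Defs.
From HB Require Import structures.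
From mathcomp Require Import all_boot all_order all_algebra.
From mathcomp Require Import all_classical all_reals all_analysis.
From mathcomp Require Import ring lra zify.
Set Implicit Arguments.
Unset Strict Implicit.
Unset Printing Implicit Defensive.
Import Order.TTheory GRing.Theory Num.Theory.
Import numFieldNormedType.Exports.
Local Open Scope classical_set_scope.
Local Open Scope ring_scope.

(** * Powers, reciprocals and uniform thresholds *)

Lemma expr_unbounded (R : realType) (x C : R) : 1 < x -> exists n, C <= x ^+ n.
Proof.
move=> x1.
have bern n : n%:R * (x - 1) <= x ^+ n.
  elim: n => [|n IH]; first by rewrite mul0r expr0 ler01.
  have xn : 1 <= x ^+ n by rewrite exprn_ege1 // ltW.
  by rewrite exprS -natr1; nra.
have x10 : 0 < x - 1 by rewrite subr_gt0.
have C0 : 0 <= `|C| / (x - 1) by rewrite divr_ge0 // ltW.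
exists (Num.bound (`|C| / (x - 1))); apply: le_trans (bern _).
have := archi_boundP C0; rewrite ltr_pdivrMr // => /ltW.
exact/le_trans/ler_norm.
Qed.

(** Lower-bound constants written [N.+1%:R^-1] let one natural number be both an index threshold and
    a constant: increasing it weakens both requirements. *)
Lemma exists_natSV_le (R : realType) (x : R) :
  0 < x -> exists N, forall M : nat, (N <= M)%N -> M.+1%:R^-1 <= x.
Proof.
move=> x0; have xV0 : 0 <= x^-1 by rewrite invr_ge0 ltW.
exists (Num.bound x^-1) => M NM.
rewrite -[leRHS]invrK lef_pV2 ?posrE ?invr_gt0 ?ltr0n //.
apply: (le_trans (ltW (archi_boundP xV0))).
by rewrite ler_nat leqW.
Qed.

(** By monotonicity, the maximum of the finitely many thresholds works for all of [s]. *)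
Lemma uniform_threshold (T : eqType) (s : seq T) (Q : T -> nat -> Prop) :
  (forall x N M, (N <= M)%N -> Q x N -> Q x M) ->
  (forall x, x \in s -> exists N, Q x N) ->
  exists N, forall x, x \in s -> Q x N.
Proof.
move=> Qmono; elim: s => [|a s IH] Qs; first by exists 0%N.
have [|N NP] := IH; first by move=> x xs; apply: Qs; rewrite inE xs orbT.
have [|M MP] := Qs a; first by rewrite inE eqxx.
exists (maxn N M) => x; rewrite inE => /predU1P[->|xs].
  exact: Qmono (leq_maxr _ _) MP.
exact: Qmono (leq_maxl _ _) (NP _ xs).
Qed.

(** * Sequences whose consecutive ratios converge *)

Lemma ratio_neq0 (R : realType) (u : nat -> R) (sigma : R) :
  1 < sigma -> (fun k => u k.+1 / u k) @ \oo --> sigma ->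
  exists N, forall k, (N <= k)%N -> u k != 0.
Proof.
move=> s1 /cvgr_gt /(_ _ s1) [N _ NP]; exists N => k /NP /=.
(* Division by [0] gives [0], so a vanishing [u k] would have ratio [0], not above [1]. *)
by apply: contraTneq => ->; rewrite invr0 mulr0 -leNgt ler01.
Qed.

(** The quotient telescopes into [d] consecutive ratios as soon as no term vanishes. *)
Lemma ratio_shift_cvg (R : realType) (u : nat -> R) (sigma : R) (d : nat) :
  1 < sigma -> (fun k => u k.+1 / u k) @ \oo --> sigma ->
  (fun k => u (k + d)%N / u k) @ \oo --> sigma ^+ d.
Proof.
move=> s1 us; have [N N0] := ratio_neq0 s1 us.
elim: d => [|d IH].
  rewrite expr0; apply: cvg_near_cst; exists N => // k /= Nk.
  by rewrite addn0 divff ?N0.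
have us' : (fun k => u (k + d).+1 / u (k + d)%N) @ \oo --> sigma.
  by move: us; rewrite -(cvg_shiftn d).
rewrite exprS; apply: cvg_trans (cvgM us' IH).
apply: near_eq_cvg; exists N => // k /= Nk.
rewrite /= addnS mulrA divfK // N0 //.
exact: leq_trans Nk (leq_addr _ _).
Qed.

Lemma ratio_shift_near (R : realType) (u : nat -> R) (sigma e : R) (d : nat) :
  1 < sigma -> (fun k => u k.+1 / u k) @ \oo --> sigma -> 0 < e ->
  exists N, forall k, (N <= k)%N ->
    `|u (k + d)%N - sigma ^+ d * u k| <= e * `|u k|.
Proof.
move=> s1 us e0; have [M M0] := ratio_neq0 s1 us.
have /cvgrPdist_le /(_ _ e0) [N _ NP] := ratio_shift_cvg (d := d) s1 us.
exists (maxn M N) => k; rewrite geq_max => /andP[/M0 uk0 /NP /=].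
rewrite distrC => h; have ->: u (k + d)%N - sigma ^+ d * u k =
  (u (k + d)%N / u k - sigma ^+ d) * u k by rewrite mulrBl divfK.
by rewrite normrM ler_wpM2r.
Qed.

Lemma ratio_growth (R : realType) (u : nat -> R) (sigma : R) :
  1 < sigma -> (fun k => u k.+1 / u k) @ \oo --> sigma ->
  exists rho N, [/\ 1 < rho, forall k, (N <= k)%N -> u k != 0 &
    forall k d, (N <= k)%N -> rho ^+ d * `|u k| <= `|u (k + d)%N|].
Proof.
move=> s1 us; have [M M0] := ratio_neq0 s1 us.
(* Any number strictly between [1] and [sigma] would do: the ratios eventually exceed it. *)
pose rho := (1 + sigma) / 2.
have rho1 : 1 < rho by rewrite /rho; lra.
have rhos : rho < sigma by rewrite /rho; lra.
have /cvgr_gt /(_ _ rhos) [N _ NP] := us.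
exists rho, (maxn M N); split=> // k; first by rewrite geq_max => /andP[/M0].
move=> d kN; elim: d => [|d IH]; first by rewrite expr0 mul1r addn0.
have: (maxn M N <= k + d)%N by rewrite (leq_trans kN) ?leq_addr.
rewrite geq_max => /andP[/M0 u0 /NP /= h].
rewrite exprS -mulrA addnS.
have r0 : 0 <= rho by lra.
apply: (le_trans (ler_wpM2l r0 IH)).
rewrite -ler_pdivlMr ?normr_gt0 // -normf_div.
exact: le_trans (ltW h) (ler_norm _).
Qed.

(** * Domination by the term of largest index *)

Lemma tail_bound (R : realType) (u : nat -> R) (b : R) (B : nat)
    (s : seq (nat * int)) :
  all (fun x => (`|x.2| <= B)%N && (`|u x.1| <= b)) s ->
  `|\sum_(x <- s) x.2%:~R * u x.1| <= (size s * B)%:R * b.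
Proof.
elim: s => [|[k c] s IH] /=; first by rewrite big_nil normr0 mul0n mul0r.
case/andP => /andP[cB ub] /IH {}IH; rewrite big_cons mulSn natrD mulrDl.
apply: le_trans (ler_normD _ _) (lerD _ IH); rewrite normrM.
apply: ler_pM => //=; rewrite -intr_norm -abszE -pmulrn ler_nat //.
Qed.

Lemma int_ball_enum (B : nat) :
  exists cs : seq int, forall c : int, (`|c| <= B)%N -> c \in cs.
Proof.
exists [seq i%:Z - B%:Z | i <- iota 0 (B + B).+1] => c cB.
apply/mapP; exists `|(c + B%:Z)%R|%N; last by lia.
by rewrite mem_iota; lia.
Qed.

(* The coefficient [H(sigma)] of the top term absorbs the terms whose index is
   within a bounded distance of the top, one at a time: it becomes
   [H(sigma) * sigma ^ d + c], which transcendence keeps away from [0].  At the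
   first long gap the remaining terms are negligible. *)
Lemma top_term_dominates (R : realType) (u : nat -> R) (sigma : R) (B m : nat)
    (H : {poly int}) :
  1 < sigma -> (fun k => u k.+1 / u k) @ \oo --> sigma ->
  (forall Q : {poly int}, Q != 0 -> (map_poly intr Q).[sigma] != 0) ->
  H != 0 ->
  exists N, forall k (s : seq (nat * int)), (size s <= m)%N ->
    path gtn k (unzip1 s) ->
    all (fun x => (N <= x.1)%N && (`|x.2| <= B)%N) s ->
    N.+1%:R^-1 * `|u k| <=
      `|(map_poly intr H).[sigma] * u k + \sum_(x <- s) x.2%:~R * u x.1|.
Proof.
move=> s1 us trans; have [rho [N0 [rho1 _ grow]]] := ratio_growth s1 us.
elim: m H => [|m IH] H /trans; set h := _.[sigma] => h0.
  have [N NP] := @exists_natSV_le R `|h| (ltac:(by rewrite normr_gt0)).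
  exists N => k [|//] _ _ _; rewrite big_nil addr0 normrM ler_wpM2r //.
  exact: NP.
have hpos : 0 < `|h| by rewrite normr_gt0.
(* After a gap of at least [D], up to [m.+1] terms with coefficients bounded by [B] add up to at
   most half of the top term [h * u k]. *)
have [D DP] := expr_unbounded (2 * (m.+1 * B)%:R / `|h|) rho1.
(* The pair [x] holds the first gap, shifted by one because indices strictly decrease, and the
   second coefficient. Short gaps and coefficients bounded by [B] leave finitely many pairs, hence a
   common threshold. *)
pose Q (x : nat * int) N := forall k' (s : seq (nat * int)), (size s <= m)%N ->
  path gtn k' (unzip1 s) -> (N <= k')%N ->
  all (fun x => (N <= x.1)%N && (`|x.2| <= B)%N) s ->
  N.+1%:R^-1 * `|u (k' + x.1.+1)%N| <=
    `|h * u (k' + x.1.+1)%N +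
      (x.2%:~R * u k' + \sum_(x <- s) x.2%:~R * u x.1)|.
have [cs csP] := int_ball_enum B.
have [||N NP] :=
    @uniform_threshold _ [seq (d, c) | d <- iota 0 D, c <- cs] Q.
- move=> x N M NM QN k' s sm ps Mk' As.
  apply: le_trans (QN k' s sm ps (leq_trans NM Mk') _).
    by rewrite ler_wpM2r // lef_pV2 ?posrE ?ltr0n // ler_nat.
  by apply: sub_all As => x' /andP[Mx ->]; rewrite (leq_trans NM Mx).
(* [H'] is the new top coefficient once [u (k' + d.+1)] is replaced by [sigma ^+ d.+1 * u k']; it is
   nonzero because [H] is. *)
- move=> [d c] _; pose H' := H * 'X^d * 'X + c%:P.
  have H0 : H != 0 by apply: contraNneq h0 => H0; rewrite /h H0 map_poly0 horner0.
  have H'0 : H' != 0.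
    rewrite -size_poly_eq0 size_MXaddC mulf_eq0 (negPf H0) /=.
    by rewrite -size_poly_eq0 size_polyXn.
  have h'E : (map_poly intr H').[sigma] = h * sigma ^+ d.+1 + c%:~R.
    rewrite /H' rmorphD rmorphM rmorphM /= map_polyXn map_polyX map_polyC.
    by rewrite !hornerE -mulrA -exprSr.
  have [N1 N1P] := IH _ H'0.
  pose e1 : R := N1.+1%:R^-1.
  have e1pos : 0 < e1 by rewrite invr_gt0 ltr0n.
  (* With this [e], that replacement costs at most half of the lower bound [e1 * |u k'|] given by
     induction. *)
  pose e := e1 / 2 / `|h|.
  have epos : 0 < e by rewrite !divr_gt0.
  have [N2 N2P] := ratio_shift_near d.+1 s1 us epos.
  (* [w] bounds the top term by a multiple of [u k'], which turns a lower bound in [u k'] into one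
     in the top term. *)
  pose w := sigma ^+ d.+1 + e.
  have wpos : 0 < w by rewrite addr_gt0 // exprn_gt0 // (lt_trans ltr01).
  have [N3 N3P] := @exists_natSV_le R (e1 / 2 / w) (ltac:(by rewrite !divr_gt0)).
  exists (maxn N1 (maxn N2 N3)) => k' s sm ps.
  rewrite !geq_max => /and3P[N1k N2k N3k] As /=.
  have {}As : all (fun x => (N1 <= x.1)%N && (`|x.2| <= B)%N) s.
    by apply: sub_all As => x; rewrite !geq_max => /andP[/and3P[-> _ _] ->].
  have := N1P k' s sm ps As; rewrite h'E -/e1 => main.
  have close := N2P _ N2k.
  set S := \sum_(x <- s) _ in main *.
  set v := u (k' + d.+1)%N in close *.
  have up : `|v| <= w * `|u k'|.
    have -> : v = (v - sigma ^+ d.+1 * u k') + sigma ^+ d.+1 * u k' by ring.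
    apply: le_trans (ler_normD _ _) _; rewrite mulrDl [leRHS]addrC lerD //.
    by rewrite normrM ger0_norm // exprn_ge0 // (le_trans ler01 (ltW s1)).
  have low : e1 / 2 * `|u k'| <= `|h * v + (c%:~R * u k' + S)|.
    have -> : h * v + (c%:~R * u k' + S) =
      ((h * sigma ^+ d.+1 + c%:~R) * u k' + S) + h * (v - sigma ^+ d.+1 * u k').
      by ring.
    have : `|h * (v - sigma ^+ d.+1 * u k')| <= e1 / 2 * `|u k'|.
      have -> : e1 / 2 = `|h| * e by rewrite /e [RHS]mulrC divfK ?normr_eq0.
      by rewrite normrM -mulrA ler_wpM2l.
    have := lerB_normD ((h * sigma ^+ d.+1 + c%:~R) * u k' + S)
      (h * (v - sigma ^+ d.+1 * u k')).
    by lra.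
  apply: le_trans low.
  have : (maxn N1 (maxn N2 N3)).+1%:R^-1 <= e1 / 2 / w.
    by apply: N3P; rewrite !leq_max leqnn !orbT.
  rewrite ler_pdivlMr // => le1.
  apply: le_trans (ler_wpM2l _ up) _; first by rewrite invr_ge0.
  by rewrite mulrA ler_wpM2r.
have [N4 N4P] := @exists_natSV_le R (`|h| / 2) (ltac:(by rewrite divr_gt0)).
have [M [NM N0M N4M]] : exists M, [/\ (N <= M)%N, (N0 <= M)%N & (N4 <= M)%N].
  by exists (maxn N (maxn N0 N4)); rewrite !leq_max !leqnn !orbT.
have MV (L : nat) : (L <= M)%N -> (M.+1%:R^-1 : R) <= L.+1%:R^-1.
  by move=> LM; rewrite lef_pV2 ?posrE ?ltr0n // ler_nat.
have Mh : M.+1%:R^-1 <= `|h| / 2 by exact: N4P.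
exists M => k [_ _ _|[k' c] s].
  by rewrite big_nil addr0 normrM ler_wpM2r // (le_trans Mh) //; lra.
rewrite [size _]/= ltnS [path _ _ _]/= [all _ _]/= big_cons.
move=> sm /andP[k'k ps] /andP[/andP[Mk' cB] As].
pose d := (k - k').-1.
have kE : k = (k' + d.+1)%N by rewrite /d prednK ?subn_gt0 // subnKC // ltnW.
(* A short gap falls under the common threshold for [Q]; a long one makes the tail negligible. *)
have [dD|Dd] := ltnP d D.
  have dc : (d, c) \in [seq (d, c) | d <- iota 0 D, c <- cs].
    by apply: (allpairs_f pair); [rewrite mem_iota | exact: csP].
  have {}As : all (fun x => (N <= x.1)%N && (`|x.2| <= B)%N) s.
    by apply: sub_all As => x /andP[Mx ->]; rewrite (leq_trans NM Mx).
  have := NP _ dc k' s sm ps (leq_trans NM Mk') As; rewrite -kE.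
  by apply: le_trans; rewrite ler_wpM2r // MV.
have N0k' := leq_trans N0M Mk'.
(* Beyond [N0] the absolute values of [u] do not decrease, so [u k'] dominates every later term of
   the list. *)
have : `|\sum_(x <- (k', c) :: s) x.2%:~R * u x.1| <=
    (size ((k', c) :: s) * B)%:R * `|u k'|.
  apply: tail_bound => /=; rewrite cB lexx /=.
  have : all (gtn k') (unzip1 s).
    by apply: order_path_min ps => a b c' /= h1 h2; apply: ltn_trans h2 h1.
  rewrite all_map => /(conj As)/andP; rewrite -all_predI.
  apply: sub_all => x /= /andP[/andP[Mx ->] xk'] /=.
  have := grow x.1 (k' - x.1)%N (leq_trans N0M Mx).
  rewrite subnKC; last exact: ltnW.
  apply: le_trans; rewrite ler_peMl // exprn_ege1 // ltW //.
rewrite big_cons /=; set S := _ * _ + _ => SB.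
have {SB} SB : `|S| <= `|h| / 2 * `|u k|.
  apply: (le_trans SB).
  apply: (@le_trans _ _ ((m.+1 * B)%:R * `|u k'|)).
    by rewrite ler_wpM2r // ler_nat leq_mul2r ltnS sm orbT.
  have gk : rho ^+ D * `|u k'| <= `|u k|.
    rewrite kE; apply: le_trans (grow k' d.+1 N0k').
    by rewrite ler_wpM2r // ler_weXn2l ?(ltW rho1) // leqW.
  have hD : (m.+1 * B)%:R <= `|h| / 2 * rho ^+ D.
    by move: DP; rewrite ler_pdivrMr //; lra.
  apply: le_trans (ler_wpM2r _ hD) _ => //.
  rewrite -[leLHS]mulrA; apply: ler_wpM2l => //; rewrite divr_ge0.
apply: le_trans (ler_wpM2r (normr_ge0 (u k)) Mh) _.
by apply: le_trans (lerB_normD _ _); rewrite normrM; lra.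
Qed.

(** * Lower bounds for combinations of terms of the set *)

Lemma ratio_unbounded (R : realType) (u : nat -> R) (sigma C : R) :
  1 < sigma -> (fun k => u k.+1 / u k) @ \oo --> sigma ->
  exists N, forall k, (N <= k)%N -> C <= `|u k|.
Proof.
move=> s1 us; have [rho [N0 [rho1 u0 grow]]] := ratio_growth s1 us.
have uN0 : 0 < `|u N0| by rewrite normr_gt0 u0.
have [n nP] := expr_unbounded (C / `|u N0|) rho1.
exists (N0 + n)%N => k Nk.
have -> : k = (N0 + (k - N0))%N by lia.
apply: le_trans (grow N0 _ (leqnn _)); rewrite -ler_pdivrMr //.
by apply: (le_trans nP); rewrite ler_weXn2l ?(ltW rho1) //; lia.
Qed.

Lemma not_algebraic_horner_neq0 (R : realType) (sigma : R) (Q : {poly int}) :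
  ~ algebraicOver (@ratr R) sigma -> Q != 0 -> (map_poly intr Q).[sigma] != 0.
Proof.
move=> trans Q0; apply/eqP => Qs; apply: trans.
exists (map_poly intr Q); first by rewrite map_poly_eq0_id0 // intr_eq0 lead_coef_eq0.
rewrite -map_poly_comp (@eq_map_poly _ _ _ intr) ?rootE ?Qs //.
by move=> z /=; rewrite ratr_int.
Qed.

(** Turns a sum over ordinals into one over a list of labels, which can then be sorted, filtered or
    split. *)
Lemma lincomb_map (T : Type) (s : seq T) (f g : T -> int) (m : nat)
    (zeta p : m.-tuple int) :
  zeta = map f s :> seq int -> p = map g s :> seq int ->
  lincomb zeta p = \sum_(x <- s) f x * g x.
Proof.
move=> zE pE; have sm : size s = m by rewrite -(size_map f) -zE size_tuple.
case: s => [|x0 s] in zE pE sm *.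
  by rewrite /lincomb big_nil; move: sm zeta p {zE pE} => <- *; rewrite big_ord0.
rewrite (big_nth x0) sm big_mkord; apply: eq_bigr => i _.
by rewrite !(tnth_nth 0) zE pE !(nth_map x0) ?sm.
Qed.

(** A single [G] serves all tuples of bounded length and coefficients: the independence property
    needs this uniformity, and the bracket needs arbitrary [C]. *)
Lemma terms_lincomb_bound (R : realType) (n_ : nat -> int) (sigma C : R)
    (B : nat) :
  1 < sigma -> (fun k => (n_ k.+1)%:~R / (n_ k)%:~R : R) @ \oo --> sigma ->
  ~ algebraicOver (@ratr R) sigma ->
  exists G : set int, [/\ finite_set G, G `<=` terms n_ &
    forall (m : nat) (zeta p : m.-tuple int), (1 <= m <= B)%N ->
      0 \notin (zeta : seq int) -> (forall i, `|tnth zeta i| <= B)%N ->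
      distinct_in (terms n_ `\` G) p -> C <= `|lincomb zeta p|%:~R].
Proof.
move=> s1 us trans; pose u k : R := (n_ k)%:~R.
(* This is the domination estimate for the constant polynomial [c], to be made uniform over the
   finitely many leading coefficients. *)
pose Q (c : int) N := c != 0 ->
  forall k (s : seq (nat * int)), (size s <= B)%N -> path gtn k (unzip1 s) ->
    all (fun x => (N <= x.1)%N && (`|x.2| <= B)%N) s ->
    N.+1%:R^-1 * `|u k| <= `|c%:~R * u k + \sum_(x <- s) x.2%:~R * u x.1|.
have [cs csP] := int_ball_enum B.
have [||N NP] := @uniform_threshold _ cs Q.
- move=> c N M NM QN c0 k s sm ps As.
  apply: le_trans (QN c0 k s sm ps _).
    by rewrite ler_wpM2r // lef_pV2 ?posrE ?ltr0n // ler_nat.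
  by apply: sub_all As => x /andP[Mx ->]; rewrite (leq_trans NM Mx).
- move=> c _; have [->|c0] := eqVneq c 0; first by exists 0%N; rewrite /Q eqxx.
  have cP0 : c%:P != 0 by rewrite polyC_eq0.
  have [N NP] := top_term_dominates B B s1 us
    (fun Q => @not_algebraic_horner_neq0 R sigma Q trans) cP0.
  by exists N => _ k s; move: (NP k s); rewrite map_polyC hornerC.
(* The factor [N.+1] compensates the constant [N.+1%:R^-1] of the domination estimate. *)
have [K KP] := ratio_unbounded (C * N.+1%:R) s1 us.
pose L := maxn N K.
exists (n_ @` [set k | (1 <= k)%N /\ (k < L)%N]); split.
- by apply/finite_image/(sub_finite_set _ (finite_II L)) => k /= [].
- by move=> _ [k [k1 _] <-]; exists k.
move=> m zeta p /andP[m1 mB] z0 zB [pU pE].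
have idx i : exists k, n_ k = tnth p i /\ (L <= k)%N.
  have [[k k1 kE] notG] := pE _ (mem_tnth i p).
  exists k; split=> //; rewrite leqNgt; apply/negP => kL.
  by apply: notG; exists k.
have [kap kapP] := choice idx.
(* Each entry of [p] receives an index at least [L]; sorting by decreasing index puts the top term
   first. *)
pose s0 := [seq (kap i, tnth zeta i) | i <- enum 'I_m].
pose s := sort (relpre fst geq) s0.
have ss0 : perm_eq s s0 by rewrite perm_sort.
have lcE : lincomb zeta p = \sum_(x <- s) x.2 * n_ x.1.
  rewrite (perm_big _ ss0) big_map; apply: lincomb_map.
    by rewrite map_tnth_enum.
  by rewrite -[LHS]map_tnth_enum; apply: eq_map => i /=; case: (kapP i).
have sU : uniq (unzip1 s).
  rewrite (perm_uniq (perm_map _ ss0)) -map_comp map_inj_uniq ?enum_uniq //.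
  move=> i j /= ij; apply/(tuple_uniqP p pU)/eqP.
  by rewrite -(kapP i).1 -(kapP j).1 ij.
have sS : sorted gtn (unzip1 s).
  rewrite gtn_sorted_uniq_geq sU /unzip1 -sort_map sort_sorted //.
have sA : all (fun x => [&& (L <= x.1)%N, (`|x.2| <= B)%N & x.2 != 0]) s.
  rewrite (perm_all _ ss0); apply/allP => _ /mapP[i _ ->] /=.
  rewrite (kapP i).2 zB /=; apply: contraNneq z0 => <-; exact: mem_tnth.
have sm : size s = m by rewrite size_sort size_map size_enum_ord.
case: s => [|[k c] s] in ss0 lcE sU sS sA sm *; first by rewrite -sm in m1.
move: sA => /= /andP[/and3P[Lk cB c0] sA].
have := NP c (csP _ cB) c0 k s _ sS _.
rewrite -sm in mB; move/(_ (ltnW mB)).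
have -> : all (fun x => (N <= x.1)%N && (`|x.2| <= B)%N) s.
  apply: sub_all sA => x /and3P[Lx -> _]; rewrite andbT.
  exact: leq_trans (leq_maxl _ _) Lx.
move=> /(_ isT).
have -> : c%:~R * u k + \sum_(x <- s) x.2%:~R * u x.1 = (lincomb zeta p)%:~R.
  rewrite lcE big_cons rmorphD rmorphM rmorph_sum /=; congr (_ + _).
  by apply: eq_bigr => x _; rewrite rmorphM.
rewrite (intr_norm R (lincomb zeta p)); apply: le_trans.
rewrite mulrC ler_pdivlMr ?ltr0n // KP //.
exact: leq_trans (leq_maxr _ _) Lk.
Qed.

(** * Integer parts of powers *)

Lemma floor_pow_increasing (R : realType) (n_ : nat -> int) (sigma : R) :
  1 < sigma ->
  (forall k : nat, (1 <= k)%N -> n_ k = Num.floor (sigma ^+ k)) ->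
  exists2 K, (1 <= K)%N & forall k, (K <= k)%N -> n_ k < n_ k.+1.
Proof.
(* From this [K] on, consecutive powers differ by at least [1], so their integer parts differ. *)
move=> s1 nE; have [K KP] := expr_unbounded (sigma - 1)^-1 s1.
exists K.+1 => // k Kk; rewrite !nE // ?(leq_trans _ Kk) //.
rewrite -lezD1 floor_ge_int rmorphD /= exprS.
have s10 : 0 < sigma - 1 by rewrite subr_gt0.
have sk : (sigma - 1)^-1 <= sigma ^+ k.
  by apply: (le_trans KP); rewrite ler_weXn2l ?(ltW s1) // ltnW.
have : 1 <= sigma ^+ k * (sigma - 1) by rewrite -ler_pdivrMr // div1r.
have := floor_le (sigma ^+ k).
lra.
Qed.

Lemma floor_pow_escapes (R : realType) (n_ : nat -> int) (sigma : R)
    (G : set int) :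
  1 < sigma ->
  (forall k : nat, (1 <= k)%N -> n_ k = Num.floor (sigma ^+ k)) ->
  finite_set G ->
  exists K, [/\ (1 <= K)%N, forall k, (K <= k)%N -> ~ G (n_ k) &
    {in [pred k | (K <= k)%N] &, injective n_}].
Proof.
move=> s1 nE /finite_seqP[s ->]; have [K K1 nlt] := floor_pow_increasing s1 nE.
have nmono k d : (K <= k)%N -> n_ k + d%:Z <= n_ (k + d)%N.
  move=> Kk; elim: d => [|d IH]; first by rewrite addr0 addn0.
  have := nlt (k + d)%N (leq_trans Kk (leq_addr _ _)).
  by rewrite addnS; lia.
pose M := (\max_(x <- s) `|x|)%N.
(* Integer parts grow by at least [1] per step from [K] on, so after this many steps they exceed
   [M], which bounds [G]. *)
exists (K + (`|n_ K| + M).+1)%N; split; first by rewrite addn_gt0 K1.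
- move=> k Kk /= ks.
  have kM : (`|n_ k| <= M)%N by exact: leq_bigmax_seq.
  have := nmono K (k - K)%N (leqnn _); rewrite subnKC; last by lia.
  by lia.
- move=> i j; rewrite !inE => Ki Kj.
  wlog ij : i j Ki Kj / (i <= j)%N.
    move=> h; have [ij|/ltnW ij] := leqP i j; first exact: h.
    by move=> e; apply/esym/h.
  move=> e; have := nmono i (j - i)%N; rewrite subnKC // e.
  by move=> /(_ ltac:(lia)); lia.
Qed.

(** Subtracting [sigma ^+ k] times [P(sigma) = 0] replaces each integer part by its rounding error,
    of absolute value at most [1]. *)
Lemma floor_pow_comb_bound (R : realType) (n_ : nat -> int) (sigma : R)
    (P : {poly int}) (k : nat) :
  0 <= sigma -> (forall k : nat, (1 <= k)%N -> n_ k = Num.floor (sigma ^+ k)) ->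
  root (map_poly intr P) sigma -> (1 <= k)%N ->
  (`|(\sum_(i < size P) P`_i * n_ (k + i)%N)%R| <= \sum_(i < size P) `|(P`_i)%R|)%N.
Proof.
move=> s0 nE Ps k1; rewrite -(ler_nat R) natr_absz intr_norm.
have Ps0 : \sum_(i < size P) (P`_i)%:~R * sigma ^+ i = 0.
  move/rootP: Ps; rewrite (@horner_coef_wide _ (size P)) ?size_poly // => Ps.
  by rewrite -[RHS]Ps; apply: eq_bigr => i _; rewrite coef_map.
have -> : (\sum_(i < size P) P`_i * n_ (k + i)%N)%:~R =
    \sum_(i < size P) (P`_i)%:~R * ((n_ (k + i)%N)%:~R - sigma ^+ (k + i)).
  under [RHS]eq_bigr do rewrite mulrBr exprD mulrCA.
  rewrite sumrB -mulr_sumr Ps0 mulr0 subr0 rmorph_sum.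
  by apply: eq_bigr => i _; rewrite rmorphM.
rewrite natr_sum; apply: le_trans (ler_norm_sum _ _ _) (ler_sum _ _) => i _.
rewrite natr_absz intr_norm normrM ler_piMr // nE; last by rewrite ltn_addr.
have := floor_itv (sigma ^+ (k + i)); rewrite rmorphD /= => /andP[h1 h2].
by rewrite ler_norml; lra.
Qed.

(** * Relations read off from the coefficients of the polynomial *)

Definition coef_support (P : {poly int}) : seq nat :=
  [seq i <- iota 0 (size P) | P`_i != 0].

(** Recovers the exponents, forgotten by [nonzero_coefs], that tell which term each coefficient
    multiplies. *)
Lemma nonzero_coefsE (P : {poly int}) :
  nonzero_coefs P = [seq P`_i | i <- coef_support P].
Proof.
rewrite /nonzero_coefs /coef_support -[in LHS](mkseq_nth 0 (polyseq P)).
by rewrite /mkseq filter_map.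
Qed.

Lemma big_coef_support (R : Type) (idx : R) (op : Monoid.law idx)
    (P : {poly int}) (F : nat -> R) :
  (forall i, P`_i = 0 -> F i = idx) ->
  \big[op/idx]_(i <- coef_support P) F i = \big[op/idx]_(i < size P) F i.
Proof.
move=> F0; rewrite big_filter big_mkcond /=.
rewrite -(big_mkord xpredT) /index_iota subn0; apply: eq_bigr => i _.
by case: eqP => // /F0.
Qed.

(** Whatever [G] is, a window of terms starting late enough avoids it, and its combination obeys a
    bound independent of [G]. *)
Lemma floor_pow_bracket (R : realType) (n_ : nat -> int) (sigma : R)
    (P : {poly int}) :
  1 < sigma -> (forall k : nat, (1 <= k)%N -> n_ k = Num.floor (sigma ^+ k)) ->
  root (map_poly intr P) sigma ->
  (bracket R (in_tuple (nonzero_coefs P)) (terms n_) < +oo)%E.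
Proof.
move=> s1 nE Ps.
apply: (@le_lt_trans _ _ ((\sum_(i < size P) `|(P`_i)%R|)%N%:R%:E)); last first.
  exact: ltry.
apply/ereal_supP => _ [G [Gfin GE] <-].
have [K [K1 Kesc Kinj]] := floor_pow_escapes s1 nE Gfin.
pose p := [seq n_ (K + i)%N | i <- coef_support P].
have psize : size p == size (nonzero_coefs P).
  by rewrite nonzero_coefsE !size_map.
have dp : distinct_in (terms n_ `\` G) (Tuple psize).
  split=> [|_ /mapP[i _ ->]] /=.
    rewrite map_inj_in_uniq ?filter_uniq ?iota_uniq // => i j _ _ /Kinj.
    by rewrite !inE !leq_addr => /(_ isT isT)/addnI.
  split; last exact/Kesc/leq_addr.
  by exists (K + i)%N => //=; rewrite ltn_addr.
apply: le_trans (ereal_inf_lbound _) _; first by exists (Tuple psize).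
rewrite lee_fin (@lincomb_map _ (coef_support P) (nth 0 P)
  (fun i => n_ (K + i)%N)) ?nonzero_coefsE //.
rewrite big_coef_support; last by move=> i ->; rewrite mul0r.
rewrite -natr_absz ler_nat (floor_pow_comb_bound _ nE Ps K1) //.
exact: (le_trans ler01 (ltW s1)).
Qed.

Lemma bounded_int_pigeonhole (B : nat) (f : nat -> int) :
  (forall t, `|f t| <= B)%N -> exists i j, (i < j)%N /\ f i = f j.
Proof.
move=> fB; have [cs csP] := int_ball_enum B.
have /(uniqPn 0)[i [j [ij]]] : ~~ uniq [seq f t | t <- iota 0 (size cs).+1].
  apply/negP => fU; have sub : {subset [seq f t | t <- iota 0 (size cs).+1] <= cs}.
    by move=> _ /mapP[t _ ->]; apply: csP.
  by have := uniq_leq_size fU sub; rewrite size_map size_iota ltnn.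
rewrite size_map size_iota => jcs; have ics := ltn_trans ij jcs.
rewrite !(nth_map 0%N) ?size_iota // !nth_iota // => e.
by exists i, j.
Qed.

(* Two equal values of the bounded integer sequence
   [k |-> \sum_i P`_i * n_ (k + i)] at indices more than [size P] apart give
   a relation with coefficients [P] and [- P]. *)
Lemma floor_pow_not_enjoys (R : realType) (n_ : nat -> int) (sigma : R)
    (P : {poly int}) :
  1 < sigma -> (forall k : nat, (1 <= k)%N -> n_ k = Num.floor (sigma ^+ k)) ->
  P != 0 -> root (map_poly intr P) sigma ->
  ~ enjoys_I (\sum_(i < size P) `|(P`_i)%R|)%N (terms n_).
Proof.
move=> s1 nE P0 Ps [G [Gfin GE Gno]].
have [K [K1 Kesc Kinj]] := floor_pow_escapes s1 nE Gfin.
pose f k := \sum_(i < size P) P`_i * n_ (k + i)%N.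
(* Sampling [f] in steps of [size P] makes the windows of different samples disjoint. *)
have [t|i [j [ij fij]]] := @bounded_int_pigeonhole
    (\sum_(i < size P) `|(P`_i)%R|)%N (fun t => f (K + t * size P)%N).
  apply: (floor_pow_comb_bound _ nE Ps); last by rewrite ltn_addr.
  exact: (le_trans ler01 (ltW s1)).
set k := (K + i * size P)%N in fij; set k' := (K + j * size P)%N in fij.
have kk' : (k + size P <= k')%N.
  by rewrite /k /k' -addnA leq_add2l -mulSnr leq_mul2r ij orbT.
have Kk : (K <= k)%N by exact: leq_addr.
have Kk' : (K <= k')%N by exact: leq_addr.
clearbody k k'.
pose s := [seq (P`_i, (k + i)%N) | i <- coef_support P] ++
          [seq (- P`_i, (k' + i)%N) | i <- coef_support P].
pose zeta := map_tuple fst (in_tuple s).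
pose r := map_tuple (fun x => n_ x.2) (in_tuple s).
have sK x : x \in s -> (K <= x.2)%N.
  by rewrite mem_cat => /orP[] /mapP[l _ ->] /=; lia.
have sU : uniq [seq x.2 | x <- s].
  have -> : [seq x.2 | x <- s] =
      map (addn k) (coef_support P) ++ map (addn k') (coef_support P).
    by rewrite map_cat -!map_comp.
  rewrite cat_uniq !(map_inj_uniq (@addnI _)) filter_uniq ?iota_uniq //= andbT.
  apply/hasPn => _ /mapP[l _ ->]; apply/mapP => -[l'].
  rewrite mem_filter mem_iota => /andP[_ lP]; apply/eqP.
  rewrite gtn_eqF // (leq_trans _ (leq_addr _ _)) // (leq_trans _ kk') //.
  by rewrite ltn_add2l.
have zetaE : zeta = [seq P`_i | i <- coef_support P] ++
    [seq - P`_i | i <- coef_support P] :> seq int.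
  by rewrite /= map_cat -!map_comp.
have : lincomb zeta r != 0.
  apply: Gno.
  - rewrite size_cat size_map addn_gt0; apply/orP; left.
    rewrite -has_predT; apply/hasP; exists (size P).-1 => //.
    rewrite mem_filter -lead_coefE lead_coef_eq0 P0 mem_iota.
    by rewrite /= add0n ltn_predL size_poly_gt0.
  - rewrite zetaE mem_cat negb_or; apply/andP; split; apply/mapP => -[l];
      rewrite mem_filter => /andP[/negPf l0 _] /esym/eqP; rewrite ?oppr_eq0 l0 //.
  - rewrite -(big_tuple _ _ zeta xpredT id) zetaE big_cat !big_map /=.
    by rewrite sumrN subrr.
  (* [P] and [- P] contribute equally, so the total is exactly twice the sum of the absolute values
     of the coefficients. *)
  - rewrite -(big_tuple _ _ zeta xpredT absz) zetaE big_cat !big_map /=.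
    under [X in (_ + X <= _)%N]eq_bigr do rewrite abszN.
    by rewrite big_coef_support ?mul2n ?addnn // => i0 ->.
  - split=> [|_ /mapP[x xs ->]] /=.
      rewrite (map_comp n_ snd) map_inj_in_uniq //.
      by move=> _ _ /mapP[x xs ->] /mapP[y ys ->]; apply: Kinj; rewrite inE sK.
    split; last by apply: Kesc; apply: sK.
    by exists x.2 => //=; apply: leq_trans K1 (sK _ xs).
rewrite (@lincomb_map _ s fst (fun x => n_ x.2)) // big_cat !big_map /=.
rewrite !big_coef_support; try by move=> i0 ->; rewrite ?oppr0 mul0r.
under [X in _ + X]eq_bigr do rewrite mulNr.
by rewrite sumrN -/(f k) -/(f k') fij subrr eqxx.
Qed.

(** * Derivation of both claims *)

Theorem proposition4p3p1 (R : realType) (n_ : nat -> int) (sigma : R)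
    (sigma_gt1 : 1 < sigma) :
  ((fun k : nat => (n_ k.+1)%:~R / (n_ k)%:~R : R) @ \oo --> sigma ->
   ~ algebraicOver (@ratr R) sigma ->
   (forall (m : nat) (zeta : m.-tuple int),
      (1 <= m)%N -> 0 \notin (zeta : seq int) ->
      bracket R zeta (terms n_) = +oo%E)
   /\ enjoys_Ioo (terms n_))
  /\
  ((forall k : nat, (1 <= k)%N -> n_ k = Num.floor (sigma ^+ k)) ->
   algebraicOver (@ratr R) sigma ->
   forall P : {poly int}, minimal_degree_root sigma P ->
     (bracket R (in_tuple (nonzero_coefs P)) (terms n_) < +oo)%E
     /\ ~ enjoys_I (\sum_(i < size P) `|(P`_i)%R|)%N (terms n_)).
Proof.
split=> [us trans|nE _ P [P0 Ps _]]; last first.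
  split; first exact: floor_pow_bracket Ps.
  exact: floor_pow_not_enjoys Ps.
split=> [m zeta m1 z0|n _].
  apply: eq_infty => C.
  have [G [Gfin GE GP]] := terms_lincomb_bound C
    (m + \sum_(i < m) `|tnth zeta i|) sigma_gt1 us trans.
  apply: le_trans (ereal_sup_ubound _); last by exists G.
  apply/ereal_infP => _ [p dp <-]; rewrite lee_fin.
  apply: GP => // [|i]; first by rewrite m1 leq_addr.
  by rewrite (bigD1 i) //= addnCA leq_addr.
(* The bound [2 * n] also controls the length [m], since each nonzero coefficient contributes at
   least [1]; an absolute value at least [1] excludes [0]. *)
have [G [Gfin GE GP]] := terms_lincomb_bound 1 (2 * n) sigma_gt1 us trans.
exists G; split=> // m zeta m1 z0 _ zn r dr.
have : (1 : R) <= `|lincomb zeta r|%:~R.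
  apply: GP => // [|i].
    rewrite m1 (leq_trans _ zn) // -[leqLHS]muln1 -[m in (m * _)%N]card_ord.
    rewrite -sum_nat_const leq_sum // => i _.
    by rewrite absz_gt0; apply: contraNneq z0 => <-; exact: mem_tnth.
  by apply: leq_trans zn; rewrite (bigD1 i) //= leq_addr.
by apply: contraTneq => ->; rewrite normr0 -ltNge ltr01.
Qed.
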